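(* If $\mathcal I$ is a Fubini $\sigma$-ideal on a zero-dimensional compact space $K$, then for any Polish group $X$ the semi-ideal $\mathcal{HI}$ is a $\sigma$-ideal.
   Context: All groups are Abelian, written additively; a Polish group is a topological group whose underlying space is Polish. A semi-ideal on a set is a nonempty family of subsets closed under taking subsets; an ideal is a semi-ideal closed under finite unions; a $\sigma$-ideal is an ideal closed under countable unions. Semi-ideals used to define Haar-$\mathcal I$ sets are assumed to satisfy $\bigcup\mathcal I=K\neq\emptyset$. A subset $A$ of a topological group $X$ is Haar-$\mathcal I$ if there exists a continuous map $f:K\to X$ such that $f^{-1}(A+x)\in\mathcal I$ for all $x\in X$. For a Polish group $X$, $\mathcal{HI}$ is the family of all subsets of Borel Haar-$\mathcal I$ sets in $X$. Fubini families: let $K$ be a topological space, $1\le n\le\omega$ and $i\in n=\{0,\dots,n-1\}$ (with $n=\omega=\{0,1,\dots\}$ allowed). For $a\in K^{n\setminus\{i\}}$ let $e_a:K\to K^n$ be the embedding sending $x\in K$ to the function $y:n\to K$ with $y(i)=x$ and $y|_{n\setminus\{i\}}=a$. For a family $\mathcal I$ of subsets of $K$ put $\mathcal I^n_i=\{A\subset K^n:\forall a\in K^{n\setminus\{i\}}\;\; e_a^{-1}(A)\in\mathcal I\}$. The family $\mathcal I$ is $n$-Fubini if there is a continuous map $h:K\to K^n$ such that for any $i\in n$ and any Borel set $B\subset K^n$ with $B\in\mathcal I^n_i$ we have $h^{-1}(B)\in\mathcal I$. The family $\mathcal I$ is called Fubini if it is $2$-Fubini (equivalently, $n$-Fubini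 for some $n$ with $2\le n\le\omega$; equivalently, $n$-Fubini for every such $n$). *)

(* Defs.v *)
From mathcomp Require Import all_boot all_order all_algebra.
From mathcomp Require Import boolp classical_sets functions cardinality reals.
From mathcomp Require Import topology normedtype sequences measure.

Set Implicit Arguments.
Unset Strict Implicit.
Unset Printing Implicit Defensive.

Import Order.TTheory GRing.Theory Num.Theory.
Local Open Scope classical_set_scope.
Local Open Scope ring_scope.

Section ideals.
Variable T : Type.
Implicit Type I : set (set T).

Definition semi_ideal I :=
  I !=set0 /\ forall A B : set T, A `<=` B -> I B -> I A.

Definition ideal I := semi_ideal I /\ setU_closed I.

Definition sigma_ideal I :=
  ideal I /\
  forall F : (set T)^nat, (forall n, I (F n)) -> I (\bigcup_n F n).

End ideals.

Definition borel (T : topologicalType) : set (set T) := <<s @open T >>.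

(* Base of clopen sets; in a compact Hausdorff space this agrees with the
   library's [zero_dimensional], which only asks that clopen sets separate
   points. *)
Definition clopen_based (T : topologicalType) := basis (@clopen T).

(* [cvg F] is not available here, as it needs a pointed carrier. *)
Definition complete_metric (R : realType) (M : metricType R) :=
  forall F : set_system M, ProperFilter F -> cauchy F -> exists x : M, F --> x.

Definition homeomorphic (S T : topologicalType) :=
  exists f : S -> T, exists g : T -> S,
    [/\ cancel f g, cancel g f, continuous f & continuous g].

Definition polish (R : realType) (T : topologicalType) :=
  (exists D : set T, countable D /\ dense D) /\
  exists M : metricType R, complete_metric M /\ homeomorphic T M.

Section haar.
Variables (K : topologicalType) (X : topologicalZmodType).
Variable I : set (set K).

Definition Haar (A : set X) :=
  exists f : K -> X,
    continuous f /\ forall x, I (f @^-1` [set a + x | a in A]).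

Definition HI : set (set X) :=
  [set A | exists B, [/\ borel B, Haar B & A `<=` B]].

End haar.

Section fubini.
(* The index set [N] stands for the ordinal n: take ['I_n] for finite n and
   [nat] for n = omega. *)
Variables (N : choiceType) (K : topologicalType).

Local Notation power := (prod_topology (fun _ : N => K)).

Definition slice_embedding (i : N) (a : {j : N | j != i} -> K) (x : K) : power :=
  fun j => if insub j is Some k then a k else x.

Definition slicewise (I : set (set K)) (i : N) : set (set power) :=
  [set A | forall a : {j : N | j != i} -> K, I (slice_embedding a @^-1` A)].

Definition Fubini_over (I : set (set K)) :=
  exists h : K -> power, continuous h /\
    forall (i : N) (B : set power),
      borel B -> slicewise I i B -> I (h @^-1` B).

End fubini.

Definition Fubini (K : topologicalType) (I : set (set K)) :=
  Fubini_over 'I_2 I.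

(* Main.v *)
Require Import Defs.
From HB Require Import structures.
From mathcomp Require Import all_boot all_order all_algebra.
From mathcomp Require Import boolp classical_sets functions cardinality reals.
From mathcomp Require Import topology normedtype sequences measure.
From mathcomp Require Import mathcomp_extra interval_inference lra finmap.

(** Let [A n] be Borel Haar-I sets. The witness of [\bigcup_n A n] is an
    infinite convolution of small witnesses of the [A n].

    A witness [f] of a Haar-I set stays a witness after composition with a
    translation of X, and two witnesses glue along a clopen set, because I is
    closed under finite unions. As K is compact with a clopen base, [f] can be
    cut into finitely many clopen pieces of small oscillation, each of which is
    translated so that it passes through 0. So a Haar-I set has witnesses with
    values in any prescribed neighbourhood of 0 ([small_Haar_witness]).

    Fix a complete metric on X. It need not be translation invariant, but the
    partial sums [\sum_(i < n) g i (y i)], [y] in K^omega, range over a compact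
    set, on which all sufficiently small translations move points by less than
    any given amount. The witnesses [g n] of [A n] can therefore be chosen one
    after another so small that the partial sums converge uniformly, to a
    continuous [S : K^omega -> X] ([convergent_Haar_witnesses]). When every
    coordinate but the n-th is fixed, [S] is [g n] plus a constant, so all
    slices in direction [n] of the preimage under [S] of a translate of [A n]
    belong to I.

    Finally, a 2-Fubini family is omega-Fubini ([Fubini_omega]): if
    [(h0, h1) : K -> K^2] is the given map, iterate it in its second coordinate,
    which gives [H x = (h0 x, h0 (h1 x), h0 (h1 (h1 x)), ...)]. As [H] pulls
    Borel sets with all their slices in one direction in I back to members of
    I, the map [S \o H] is a witness of every [A n] at once, hence of their
    union, since I is a sigma-ideal. *)

Set Implicit Arguments.
Unset Strict Implicit.
Unset Printing Implicit Defensive.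

Import Order.TTheory GRing.Theory Num.Theory.
Local Open Scope classical_set_scope.
Local Open Scope ring_scope.

(** * Borel sets and powers *)

Lemma continuous_compose (S T U : topologicalType) (f : S -> T) (g : T -> U) :
  continuous f -> continuous g -> continuous (fun x => g (f x)).
Proof. by move=> cf cg x; exact: (continuous_comp (cf x) (cg _)). Qed.

Lemma borel_preimage (S T : topologicalType) (f : S -> T) (B : set T) :
  continuous f -> borel B -> borel (f @^-1` B).
Proof.
move=> cf; apply: (smallest_sub (X := [set B | borel (f @^-1` B)])); last first.
  by move=> U oU; apply: sub_sigma_algebra; exact: (continuousP f).1.
split=> /=.
- by rewrite preimage_set0; exact: sigma_algebra0.
- by move=> A bA; rewrite setTD preimage_setC -setTD; exact: sigma_algebraCD.
- by move=> F bF; rewrite preimage_bigcup; exact: sigma_algebra_bigcup.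
Qed.

Section powers.
Variables (N : choiceType) (K : topologicalType).
Local Notation power := (prod_topology (fun _ : N => K)).

Lemma continuous_coordinates (Y : topologicalType) (f : Y -> power) :
  (forall i, continuous (fun y => f y i)) -> continuous f.
Proof.
move=> cf y; apply/cvg_sup => i.
exact: (@continuous_comp_initial _ _ _ (@proj N (fun=> K) i) f (cf i) y).
Qed.

(** A slice is more easily handled as a line through a point [y] of the whole
    power, with [y i] replaced, than through a family on the other indices. *)
Lemma slicewise_dfwith (I : set (set K)) (i : N) (A : set power) :
  slicewise I i A -> forall y, I (dfwith y i @^-1` A).
Proof.
move=> IA y.
suff -> : dfwith y i = slice_embedding (fun k : {j | j != i} => y (val k)).
  exact: IA.
apply/funext => t; apply/funext => j; rewrite /slice_embedding.
case: insubP => [k ji <-|/negbNE/eqP->]; last by rewrite dfwithin.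
by rewrite dfwithout // eq_sym (valP k).
Qed.

Lemma dfwith_slicewise (t0 : K) (I : set (set K)) (i : N) (A : set power) :
  (forall y, I (dfwith y i @^-1` A)) -> slicewise I i A.
Proof.
move=> IA a.
suff -> : slice_embedding a = dfwith (slice_embedding a t0) i by exact: IA.
apply/funext => t; apply/funext => j.
rewrite /slice_embedding; case: dfwithP => [|k ik].
  by case: insubP => // k; rewrite eqxx.
by case: insubP => // /negbNE; rewrite eq_sym (negbTE ik).
Qed.

End powers.

(** * From pairs to sequences *)

Definition prepend (T : Type) (s : T) (y : nat -> T) : nat -> T :=
  fun n => if n is n'.+1 then y n' else s.

Section Fubini_omega.
Variable K : topologicalType.
Local Notation power := (prod_topology (fun _ : nat => K)).

Lemma prepend_dfwith0 (s t : K) (z : power) :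
  prepend t z = dfwith (prepend s z) 0%N t.
Proof.
apply/funext => -[|n] /=; first by rewrite dfwithin.
by rewrite dfwithout.
Qed.

Lemma prepend_dfwithS (s t : K) (z : power) (i : nat) :
  prepend s (dfwith z i t) = dfwith (prepend s z) i.+1 t.
Proof.
apply/funext => -[|n] /=; first by rewrite dfwithout.
case: dfwithP => [|j ij]; first by rewrite dfwithin.
by rewrite dfwithout.
Qed.

(** Writing [H x = (h0 x, H (h1 x))], a statement on [H @^-1` B] becomes one on
    the preimage of [B] under [p |-> (p 0, H (p 1))], a subset of K^2. Its
    slices in direction 0 are slices of [B] in direction 0; its slices in
    direction 1 are sets [H @^-1` B'] where [B'] collects the sequences that
    lie in [B] once a fixed term is put in front, so that the slices of [B] in
    direction [i.+1] are those of [B'] in direction [i]. This is an induction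
    on [i]. *)
Lemma Fubini_omega (t0 : K) (I : set (set K)) : Fubini I -> Fubini_over nat I.
Proof.
move=> [h [hc hI]].
pose h0 x : K := h x ord0; pose h1 x : K := h x ord_max.
pose square := prod_topology (fun _ : 'I_2 => K).
have coord (i : 'I_2) : continuous (fun p : square => p i).
  exact: (@proj_continuous _ (fun=> K)).
have h0c : continuous h0.
  exact: (continuous_compose hc (coord _)).
have h1c : continuous h1.
  exact: (continuous_compose hc (coord _)).
pose H x : power := fun n => h0 (iter n h1 x).
have HE x : H x = prepend (h0 x) (H (h1 x)).
  by apply/funext => -[|n] //=; rewrite /H iterSr.
have Hc : continuous H.
  apply: continuous_coordinates => n; apply: continuous_compose h0c.
  elim: n => [|n IHn]; first by move=> x; exact: cvg_id.
  exact: continuous_compose IHn h1c.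
pose split (p : square) : power := prepend (p ord0) (H (p ord_max)).
have splitc : continuous split.
  apply: continuous_coordinates => -[|n] /=; first exact: coord.
  have projc : continuous (fun y : power => y n).
    exact: (@proj_continuous _ (fun=> K)).
  exact: (continuous_compose (coord ord_max) (continuous_compose Hc projc)).
have HsplitE (B : set power) : H @^-1` B = h @^-1` (split @^-1` B).
  by apply/funext => x /=; rewrite HE.
exists H; split=> // i; elim: i => [|i IHi] B Bb IB.
  rewrite HsplitE; apply: (hI ord0); first exact: borel_preimage.
  apply: (dfwith_slicewise t0) => y.
  have := slicewise_dfwith IB (prepend t0 (H (y ord_max))).
  congr I; apply/funext => t /=; rewrite -prepend_dfwith0 /split dfwithin.
  by rewrite dfwithout.
rewrite HsplitE; apply: (hI ord_max); first exact: borel_preimage.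
apply: (dfwith_slicewise t0) => y.
have prependc : continuous (prepend (y ord0) : power -> power).
  apply: continuous_coordinates => -[|n] /=; first exact: cst_continuous.
  exact: (@proj_continuous _ (fun=> K)).
have := IHi _ (borel_preimage prependc Bb).
rewrite (_ : H @^-1` _ = dfwith y ord_max @^-1` (split @^-1` B)).
  apply; apply: (dfwith_slicewise t0) => z.
  have := slicewise_dfwith IB (prepend (y ord0) z).
  by congr I; apply/funext => t /=; rewrite -prepend_dfwithS.
by apply/funext => t /=; rewrite /split dfwithin dfwithout.
Qed.

End Fubini_omega.

(** * Small witnesses of Haar-I sets *)

Lemma clopen_patch_continuous (S T : topologicalType) (U : set S)
    (f g : S -> T) :
  clopen U -> continuous f -> continuous g -> continuous (patch g U f).
Proof.
move=> [oU cU] cf cg t; case: (pselect (U t)) => Ut.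
  rewrite /continuous_at {2}/patch mem_set //.
  apply: cvg_trans (cf t); apply: near_eq_cvg.
  have : \forall s \near t, U s by apply: open_nbhs_nbhs.
  by apply: filterS => s Us; rewrite /patch mem_set.
rewrite /continuous_at {2}/patch memNset //.
apply: cvg_trans (cg t); apply: near_eq_cvg.
have : \forall s \near t, (~` U) s.
  by apply: open_nbhs_nbhs; split => //; exact: closed_openC.
by apply: filterS => s Us; rewrite /patch memNset.
Qed.

Section witnesses.
Variables (K : topologicalType) (X : topologicalZmodType) (I : set (set K)).
Hypothesis idealI : ideal I.

Definition Haar_witness (A : set X) (f : K -> X) :=
  continuous f /\ forall x, I (f @^-1` [set a + x | a in A]).

Lemma translateE (A : set X) x y : [set a + x | a in A] y = A (y - x).
Proof.
apply/propext; split=> [[a Aa <-]|Ayx]; first by rewrite addrK.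
by exists (y - x); rewrite ?subrK.
Qed.

Lemma continuous_add_fun (S : topologicalType) (f g : S -> X) :
  continuous f -> continuous g -> continuous (fun s => f s + g s).
Proof.
move=> cf cg s.
have cfg : (f t, g t) @[t --> s] --> (f s, g s).
  by apply: cvg_pair; [exact: cf|exact: cg].
exact: (continuous_comp cfg (@add_continuous X (f s, g s))).
Qed.

Lemma Haar_witness_translate (A : set X) (f : K -> X) (c : X) :
  Haar_witness A f -> Haar_witness A (fun t => f t - c).
Proof.
move=> [cf If]; split=> [|x].
  by apply: continuous_add_fun => //; exact: cst_continuous.
have := If (x + c); congr I; apply/funext => t.
by rewrite /preimage /mkset !translateE opprD addrA [f t - x - c]addrAC.
Qed.

Lemma Haar_witness_patch (A : set X) (U : set K) (f g : K -> X) : clopen U ->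
  Haar_witness A f -> Haar_witness A g -> Haar_witness A (patch g U f).
Proof.
move: idealI => [[_ subI] UI] clU [cf If] [cg Ig]; split=> [|x].
  exact: clopen_patch_continuous.
apply: subI (UI _ _ (If x) (Ig x)) => t /=; rewrite /patch.
by case: ifP => _; [left|right].
Qed.

(** The gluing runs over a list of points whose clopen neighbourhoods, on each
    of which [f] oscillates within [V], cover K. *)
Lemma small_Haar_witness (A V : set X) :
  compact [set: K] -> clopen_based K -> nbhs 0 V -> Haar I A ->
  exists g, Haar_witness A g /\ forall t, V (g t).
Proof.
move=> compactK [_ baseK] V0 [f wf].
have small p : exists U : set K,
    [/\ clopen U, U p & forall t, U t -> V (f t - f p)].
  have cfp : continuous (fun t => f t - f p).
    by apply: continuous_add_fun; [exact: wf.1|exact: cst_continuous].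
  have : nbhs p ((fun t => f t - f p) @^-1` V) by apply: cfp; rewrite subrr.
  by move=> /baseK [U [clU Up] UV]; exists U; split.
have [U smallU] := choice small.
have glue (s : seq K) : exists g, Haar_witness A g /\
    forall t, (exists2 p, p \in s & U p t) -> V (g t).
  elim: s => [|p s [g [wg gV]]]; first by exists f; split=> // t [p].
  have [clU Up UV] := smallU p.
  exists (patch g (U p) (fun t => f t - f p)); split.
    by apply: Haar_witness_patch wg => //; exact: Haar_witness_translate.
  move=> t [q qs Uqt]; rewrite /patch; case: ifPn => [/set_mem/UV//|/negP Upt].
  apply: gV; exists q => //; move: qs; rewrite in_cons => /orP[/eqP qp|//].
  by case: Upt; apply/mem_set; rewrite -qp.
have cover : exists s : seq K, forall t, exists2 p, p \in s & U p t.
  case: (pselect ([set: K] !=set0)) => [[p0 _]|K0]; last first.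
    by exists [::] => t; case: K0; exists t.
  (* [compact_cover] is about spaces with a base point. *)
  pose K' : ptopologicalType :=
    HB.pack (K : Type) (isPointed.Build K p0) (Topological.on K).
  have : cover_compact [set: K'] by rewrite -compact_cover; exact: compactK.
  move=> /(_ K setT U); case=> [p _||D _ DU]; first by case: (smallU p) => -[].
    by move=> t _; exists t => //; case: (smallU t).
  by exists (enum_fset D) => t; have [p Dp Upt] := DU t Logic.I; exists p.
have [s sK] := cover; have [g [wg gV]] := glue s.
by exists g; split=> // t; exact: gV.
Qed.

End witnesses.

(** * Uniform limits in a complete metric *)

Section limits.
Variables (R : realType) (M : metricType R).
Local Notation r n := (1 / 2 ^+ n : R).

Lemma radius_gt0 n : 0 < r n.
Proof. by rewrite divr_gt0 // exprn_gt0. Qed.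

Lemma radius_halves n : r n = r n.+1 + r n.+1.
Proof. by rewrite !mul1r exprS invfM; lra. Qed.

(** Steps of size [r n.+1] suit the induction because [r n] is twice [r n.+1]:
    what remains after the first step fits into the other half. *)
Lemma geometric_steps_ball (u : nat -> M) :
  (forall n, ball (u n) (r n.+1) (u n.+1)) ->
  forall k n, ball (u n) (r n) (u (n + k)%N).
Proof.
move=> step; elim=> [|k IHk] n.
  by rewrite addn0; apply: ballxx; exact: radius_gt0.
by rewrite addnS -addSn radius_halves; apply: ball_triangle (step n) (IHk _).
Qed.

Lemma geometric_steps_cvg (u : nat -> M) : complete_metric M ->
  (forall n, ball (u n) (r n.+1) (u n.+1)) -> exists l : M, u @ \oo --> l.
Proof.
move=> complM step; apply: complM; apply: cauchy_exP => e e0.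
have [n _ /(_ n (leqnn n)) rn] := near_infty_natSinv_expn_lt (PosNum e0).
exists (u n), n => // m /= nm; apply: (le_ball (ltW rn)).
by rewrite -(subnKC nm); exact: geometric_steps_ball.
Qed.

Lemma geometric_steps_continuous (Y : topologicalType) (T : nat -> Y -> M) :
  complete_metric M -> (forall n, continuous (T n)) ->
  (forall n y, ball (T n y) (r n.+1) (T n.+1 y)) ->
  exists G : Y -> M, continuous G /\ forall y, T ^~ y @ \oo --> G y.
Proof.
move=> complM cT step.
have [G TG] := choice (fun y => geometric_steps_cvg complM (step ^~ y)).
exists G; split=> // y; apply/cvg_ballP => e e0.
have unif n z : ball (T n z) (r n + r n) (G z).
  have [N _ TN] := cvg_ball (TG z) (radius_gt0 n).
  have := geometric_steps_ball (u := T ^~ z) (step ^~ z) N n.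
  move=> /ball_triangle; apply; apply: ball_sym.
  by apply: TN; rewrite /= leq_addl.
(* The path from [G y] to [G z] through [T n y] and [T n z] has length at most
   [5 * r n]. *)
have e6 : 0 < e / 6 by lra.
have [n _ /(_ n (leqnn n)) rn] := near_infty_natSinv_expn_lt (PosNum e6).
have : \forall z \near y, ball (T n y) (r n) (T n z).
  exact: (cvg_ball (cT n y) (radius_gt0 n)).
apply: filterS => z Tz.
have : r n + r n + r n + (r n + r n) <= e by move: rn => /=; lra.
move=> /le_ball; apply; apply: ball_triangle (unif n z).
by apply: ball_triangle Tz; apply: ball_sym.
Qed.

End limits.

Section translation.
Variables (R : realType) (X : topologicalZmodType) (M : metricType R).

(** This uniformity over a compact set replaces an invariant metric. *)
Lemma compact_near_translation (phi : X -> M) (C : set X) (e : R) :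
  continuous phi -> compact C -> 0 < e ->
  \forall v \near (0 : X), forall s, C s -> ball (phi s) e (phi (s + v)).
Proof.
move=> cphi /compact_near_coveringP covC e0.
apply: (covC X (nbhs 0) (fun v s => ball (phi s) e (phi (s + v)))) => s Cs.
have e2 : 0 < e / 2 by lra.
have near_s : \forall x \near s, ball (phi s) (e / 2) (phi x).
  exact: (cvg_ball (cphi s) e2).
have near_sv : \forall p \near ((s, 0) : X * X),
    ball (phi s) (e / 2) (phi (p.1 + p.2)).
  have := @add_continuous X (s, 0); rewrite /continuous_at /= addr0.
  by move=> /(_ _ near_s).
have near_s' : \forall p \near ((s, 0) : X * X),
    ball (phi s) (e / 2) (phi p.1).
  exact: (cvg_fst near_s).
apply: filterS (filterI near_s' near_sv) => -[s' v] /= [h1 h2].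
by rewrite [e]splitr; apply: ball_triangle h2; exact: ball_sym.
Qed.

End translation.

(** * The infinite convolution *)

Lemma polish_hausdorff (R : realType) (X : topologicalType) :
  polish R X -> hausdorff_space X.
Proof.
move=> [_ [M [_ [phi [psi [phiK psiK cphi cpsi]]]]]] x y xy.
apply: (can_inj phiK); apply: (@metric_hausdorff R M) => U V Ux Vy.
have [z [Uz Vz]] := xy _ _ (cphi x _ Ux) (cphi y _ Vy).
by exists (phi z).
Qed.

Section series.
Variables (R : realType) (K : topologicalType) (X : topologicalZmodType).
Variable I : set (set K).
Hypotheses (compactK : compact [set: K]) (zero_dimK : clopen_based K).
Hypotheses (idealI : ideal I) (polishX : polish R X).
Local Notation power := (prod_topology (fun _ : nat => K)).

(** The set [C n] of all values of the [n]-th partial sum is compact, and is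
    known before [g n] is chosen; [g n] has to be small with respect to it. *)
Lemma convergent_Haar_witnesses (A : nat -> set X) : (forall n, Haar I (A n)) ->
  exists (g : nat -> K -> X) (S : power -> X),
    [/\ forall n, Haar_witness I (A n) (g n), continuous S &
        forall y : power, (fun m => \sum_(i < m) g i (y i)) @ \oo --> S y].
Proof.
move=> HaarA.
have [_ [M [complM [phi [psi [phiK psiK cphi cpsi]]]]]] := polishX.
(* The choice is made for all pairs of an index and a set at once, which turns
   the recursion for [C] into a plain one. The value at sets that are not
   compact is arbitrary. *)
have step (nC : nat * set X) : exists g : K -> X, compact nC.2 ->
    Haar_witness I (A nC.1) g /\ forall s, nC.2 s ->
      forall t, ball (phi s) (1 / 2 ^+ nC.1.+1) (phi (s + g t)).
  case: nC => n C /=; case: (pselect (compact C)) => [compC|]; last first.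
    by move=> ncompC; exists (fun=> 0).
  have near0 := compact_near_translation cphi compC (radius_gt0 R n.+1).
  have [g [wg gV]] :=
    small_Haar_witness idealI compactK zero_dimK near0 (HaarA n).
  by exists g => _; split=> // s Cs t; exact: gV.
have [sel selP] := choice step.
pose C := fix C n := if n is n'.+1
  then [set st.1 + sel (n', C n') st.2 | st in C n' `*` [set: K]] else [set 0].
pose g n := sel (n, C n).
have compC n : compact (C n) /\ Haar_witness I (A n) (g n).
  suff cC : compact (C n) by split=> //; exact: (selP (n, C n) cC).1.
  elim: n => [|n IHn] /=; first exact: compact_set1.
  apply: continuous_compact; last exact: compact_setX.
  apply: continuous_subspaceT.
  apply: continuous_add_fun; first by move=> st; exact: cvg_fst.
  apply: continuous_compose (selP (n, C n) IHn).1.1.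
  by move=> st; exact: cvg_snd.
pose T m (y : power) := \sum_(i < m) g i (y i).
have TS m y : T m.+1 y = T m y + g m (y m) by rewrite /T big_ord_recr.
have TC m y : C m (T m y).
  elim: m => [|m IHm]; first by rewrite /T big_ord0.
  by rewrite TS; exists (T m y, y m).
have cT m : continuous (T m).
  elim: m => [|m IHm].
    have -> : T 0%N = fun=> 0 by apply/funext => y; rewrite /T big_ord0.
    exact: cst_continuous.
  have -> : T m.+1 = fun y => T m y + g m (y m) by apply/funext => y; exact: TS.
  apply: continuous_add_fun => //; apply: continuous_compose (compC m).2.1.
  exact: (@proj_continuous _ (fun=> K)).
have Tstep m y : ball (phi (T m y)) (1 / 2 ^+ m.+1) (phi (T m.+1 y)).
  by rewrite TS; apply: (selP (m, C m) (compC m).1).2; exact: TC.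
have cphiT m : continuous (phi \o T m) by exact: continuous_compose.
have [G [cG TG]] := geometric_steps_continuous complM cphiT Tstep.
exists g, (psi \o G); split=> [n||y]; first exact: (compC n).2.
  exact: continuous_compose.
rewrite (_ : (fun m => _) = psi \o (fun m => phi (T m y))).
  by apply: cvg_comp (TG y) _; exact: cpsi.
by apply/funext => m /=; rewrite phiK.
Qed.

End series.

Lemma sum_dfwith (K : Type) (X : zmodType) (g : nat -> K -> X) (y : nat -> K)
    (n m : nat) (t : K) : (n < m)%N ->
  \sum_(i < m) g i (dfwith y n t i) =
  \sum_(i < m) g i (y i) + (g n t - g n (y n)).
Proof.
move=> nm; rewrite (bigD1 (Ordinal nm)) //= dfwithin.
rewrite [in RHS](bigD1 (Ordinal nm)) //= [RHS]addrC.
rewrite addrA subrK; congr (_ + _); apply: eq_bigr => i ni.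
by rewrite dfwithout // eq_sym.
Qed.

Lemma Haar_bigcup (R : realType) (K : topologicalType) (X : topologicalZmodType)
    (I : set (set K)) (A : nat -> set X) :
  compact [set: K] -> clopen_based K -> [set: K] !=set0 ->
  sigma_ideal I -> Fubini I -> polish R X ->
  (forall n, borel (A n)) -> (forall n, Haar I (A n)) ->
  Haar I (\bigcup_n A n).
Proof.
move=> compactK zero_dimK [t0 _] [idealI bigI] FubiniI polishX borelA HaarA.
have [g [S [wg cS gS]]] :=
  convergent_Haar_witnesses compactK zero_dimK idealI polishX HaarA.
have [h [ch hI]] := Fubini_omega t0 FubiniI.
exists (S \o h); split=> [|x]; first exact: continuous_compose.
have [[_ subI] _] := idealI.
(* [B n] is the preimage under [S] of the translate of [A n] by [x]. *)
pose B n : set (prod_topology (fun _ : nat => K)) := [set y | A n (S y - x)].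
suff IB n : I (h @^-1` B n).
  apply: subI (bigI _ IB) => t.
  by rewrite /preimage/mkset translateE => -[n _ An]; exists n.
apply: (hI n).
  apply: (borel_preimage (f := fun y => S y - x)) => //.
  by apply: continuous_add_fun => //; exact: cst_continuous.
(* Along the n-th line through [y], the map [S] is [g n] translated by [c]. *)
apply: (dfwith_slicewise t0) => y.
pose c := S y - g n (y n).
have Sslice t : S (dfwith y n t) = g n t + c.
  have -> : g n t + c = S y + (g n t - g n (y n)) by rewrite /c addrCA.
  apply: (cvg_unique (polish_hausdorff polishX) (gS _)).
  have cadd : continuous (fun z => z + (g n t - g n (y n))).
    apply: continuous_add_fun; first by move=> z; exact: cvg_id.
    exact: cst_continuous.
  apply: cvg_trans (cvg_comp _ _ (gS y) (cadd _)).
  apply: near_eq_cvg; exists n.+1 => // m /= nm.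
  by rewrite sum_dfwith.
have := (wg n).2 (x - c); congr I; apply/funext => t.
by rewrite /preimage /B /mkset translateE Sslice opprB addrA.
Qed.


Theorem theorem12p4 (R : realType) (K : topologicalType) (I : set (set K))
    (compactK : compact [set: K]) (zero_dimK : clopen_based K)
    (K_neq0 : [set: K] !=set0) (coverI : \bigcup_(A in I) A = [set: K])
    (sigmaI : sigma_ideal I) (FubiniI : Fubini I)
    (X : topologicalZmodType) (polishX : polish R X) :
  sigma_ideal (@HI K X I).
Proof.
have [idealI _] := sigmaI; have [[[A0 IA0] subI] _] := idealI.
have HI_bigcup (F : (set X)^nat) :
    (forall n, HI I (F n)) -> HI I (\bigcup_n F n).
  move=> /choice[B HB]; exists (\bigcup_n B n); split.
  - by apply: sigma_algebra_bigcup => n; case: (HB n).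
  - apply: (Haar_bigcup compactK zero_dimK _ sigmaI FubiniI polishX) => // n;
      by case: (HB n).
  - by apply: subset_bigcup => n _; case: (HB n).
have HI0 : HI I (set0 : set X).
  exists set0; split=> //; first exact: sigma_algebra0.
  exists (fun=> 0); split=> [|x]; first exact: cst_continuous.
  by apply: subI IA0 => t [].
split=> //; split; first split.
- by exists set0.
- move=> A A' AA' [B [bB HB A'B]]; exists B; split=> //.
  exact: subset_trans A'B.
- by move=> A A' HA HA'; rewrite -bigcup2E; apply: HI_bigcup => -[|[|n]].
Qed.
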